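(* Let $A$ be a finitely generated torsion-free abelian group and let $B$ be a solvable group. Let $C_A \leq A$ and $C_B \leq B$ be subgroups and let $\theta : C_A \to C_B$ be an isomorphism. Then the generalized free product $G = \{A \ast B \,;\, C_A = C_B\}$ of $A$ and $B$, in which $C_A$ and $C_B$ are identified via $\theta$, is residually solvable.
   Context: The generalized free product (amalgamated free product) $\{A \ast B \,;\, C_A = C_B\}$ is the quotient of the free product $A \ast B$ by the normal closure of the set $\{c\,\theta(c)^{-1} : c \in C_A\}$. A group $G$ is residually solvable if for every non-identity element $g \in G$ there is a homomorphism $\psi$ from $G$ to a solvable group such that $\psi(g) \neq 1$. *)

(* Defs.v *)
From HB Require Import structures.
From mathcomp Require Import all_boot.
From mathcomp Require Import boolp classical_sets.

Set Implicit Arguments.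
Unset Strict Implicit.
Unset Printing Implicit Defensive.

Local Open Scope group_scope.
Local Open Scope classical_set_scope.
Local Open Scope quotient_scope.

(* Groups are [groupType]s, hence carry a choice structure, which every type
   has classically. Subgroups are boolean predicates; membership is made
   boolean with the classical [`[< _ >]]. Between groups, a map in
   [{multiplicative G -> H}] is a homomorphism: it automatically preserves 1
   and inverses. *)

Definition generated (G : groupType) (X : set G) : {pred G} :=
  fun x => `[< forall S : groupClosed G, {in X, forall y, y \in S} -> x \in S >].

Definition finitely_generated (G : groupType) : Prop :=
  exists s : seq G, forall x : G, x \in generated [set` s].

Definition torsion_free (G : groupType) : Prop :=
  forall (x : G) (n : nat), (0 < n)%N -> x ^+ n = 1 -> x = 1.

Definition abelian_group (G : groupType) : Prop :=
  forall x y : G, commute x y.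

Fixpoint derived_series (G : groupType) (n : nat) : {pred G} :=
  if n is m.+1 then
    generated [set z : G | exists x y : G,
      [/\ x \in derived_series m, y \in derived_series m & z = [~ x, y]]]
  else predT.

Definition solvable_group (G : groupType) : Prop :=
  exists n : nat, forall x : G, x \in derived_series n -> x = 1.

Definition residually_solvable (G : groupType) : Prop :=
  forall g : G, g <> 1 ->
    exists (H : groupType) (psi : {multiplicative G -> H}),
      solvable_group H /\ psi g <> 1.

HB.mixin Record isConjClosed (G : groupType) (S : {pred G}) := {
  conj_closed : forall x g, x \in S -> x ^ g \in S
}.

#[short(type="normalClosed")]
HB.structure Definition NormalClosed (G : groupType) :=
  {S of GroupClosed G S & isConjClosed G S}.

Section NormalClosure.
Variables (G : groupType) (X : set G).

Definition normal_closure : {pred G} :=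
  fun x => `[< forall N : normalClosed G, {in X, forall y, y \in N} -> x \in N >].

Fact normal_closureM : mulg_closed normal_closure.
Proof.
move=> x y /asboolP Hx /asboolP Hy; apply/asboolP => N XN.
by rewrite gpredM ?Hx ?Hy.
Qed.
Fact normal_closure1 : 1 \in normal_closure.
Proof. by apply/asboolP => N _; rewrite gpred1. Qed.
Fact normal_closureV : invg_closed normal_closure.
Proof. by move=> x /asboolP Hx; apply/asboolP => N XN; rewrite gpredVr ?Hx. Qed.
Fact normal_closureJ x g : x \in normal_closure -> x ^ g \in normal_closure.
Proof.
by move=> /asboolP Hx; apply/asboolP => N XN; apply: conj_closed; exact: Hx.
Qed.

HB.instance Definition _ := isMulClosed.Build G normal_closure normal_closureM.
HB.instance Definition _ := isMul1Closed.Build G normal_closure normal_closure1.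
HB.instance Definition _ := isInvClosed.Build G normal_closure normal_closureV.
HB.instance Definition _ := isConjClosed.Build G normal_closure normal_closureJ.
End NormalClosure.

Section QuotientGroup.
Variables (G : groupType) (N : normalClosed G).

Definition coset_rel : rel G := fun x y => x^-1 * y \in N.

Fact coset_rel_refl : reflexive coset_rel.
Proof. by move=> x; rewrite /coset_rel mulVg gpred1. Qed.
Fact coset_rel_sym : symmetric coset_rel.
Proof. by move=> x y; rewrite /coset_rel -gpredV invgM invgK. Qed.
Fact coset_rel_trans : transitive coset_rel.
Proof.
by move=> y x z xy yz; rewrite /coset_rel -(mulVKg y z) mulgA gpredM.
Qed.

Canonical coset_equiv :=
  EquivRel coset_rel coset_rel_refl coset_rel_sym coset_rel_trans.

Definition quotient_group := {eq_quot coset_equiv}.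
HB.instance Definition _ := Choice.on quotient_group.
HB.instance Definition _ := EqQuotient.on quotient_group.

Definition quotient_one : quotient_group := \pi_quotient_group 1.
Definition quotient_inv := lift_op1 quotient_group (@inv G).
Definition quotient_mul := lift_op2 quotient_group (@mul G).

Fact quotient_invE x :
  quotient_inv (\pi_quotient_group x) = \pi_quotient_group (x^-1).
Proof.
unlock quotient_inv; case: piP => y /eqmodP; rewrite /= /coset_rel => xy.
apply/eqmodP; rewrite /= /coset_rel invgK.
rewrite (_ : _ * _ = (x^-1 * y) ^ x^-1) ?conj_closed //.
by rewrite conjgE invgK !mulgA mulgV mul1g.
Qed.

Fact quotient_mulE x y :
  quotient_mul (\pi_quotient_group x) (\pi_quotient_group y)
  = \pi_quotient_group (x * y).
Proof.
unlock quotient_mul; case: piP => x' /eqmodP; rewrite /= /coset_rel => xx'.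
case: piP => y' /eqmodP; rewrite /= /coset_rel => yy'.
apply/esym/eqmodP; rewrite /= /coset_rel.
rewrite (_ : _ * _ = (x^-1 * x') ^ y * (y^-1 * y')).
  by rewrite gpredM ?conj_closed.
by rewrite conjgE invgM -!mulgA mulVKg.
Qed.

Fact quotient_mulA : associative quotient_mul.
Proof.
move=> a b c; rewrite -[a]reprK -[b]reprK -[c]reprK.
by rewrite !quotient_mulE mulgA.
Qed.
Fact quotient_1mul : left_id quotient_one quotient_mul.
Proof. by move=> a; rewrite -[a]reprK quotient_mulE mul1g. Qed.
Fact quotient_mul1 : right_id quotient_one quotient_mul.
Proof. by move=> a; rewrite -[a]reprK quotient_mulE mulg1. Qed.
Fact quotient_Vmul : left_inverse quotient_one quotient_inv quotient_mul.
Proof. by move=> a; rewrite -[a]reprK quotient_invE quotient_mulE mulVg. Qed.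
Fact quotient_mulV : right_inverse quotient_one quotient_inv quotient_mul.
Proof. by move=> a; rewrite -[a]reprK quotient_invE quotient_mulE mulgV. Qed.

HB.instance Definition _ := isGroup.Build quotient_group
  quotient_mulA quotient_1mul quotient_mul1 quotient_Vmul quotient_mulV.
End QuotientGroup.

Section FreeProduct.
Variables A B : groupType.

(* The free product is the monoid of words on the disjoint union of A and B,
   modulo the least congruence identifying each one-letter word [1] with the
   empty word and each product of two letters of the same factor with the
   corresponding single letter. *)
Inductive word_eq : seq (A + B) -> seq (A + B) -> Prop :=
| word_eq_refl u : word_eq u u
| word_eq_sym u v : word_eq u v -> word_eq v u
| word_eq_trans v u w : word_eq u v -> word_eq v w -> word_eq u w
| word_eq_cat u u' v v' :
    word_eq u u' -> word_eq v v' -> word_eq (u ++ v) (u' ++ v')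
| word_eq_l1 : word_eq [:: inl 1] [::]
| word_eq_r1 : word_eq [:: inr 1] [::]
| word_eq_lM a a' : word_eq [:: inl a; inl a'] [:: inl (a * a')]
| word_eq_rM b b' : word_eq [:: inr b; inr b'] [:: inr (b * b')].

Definition word_rel : rel (seq (A + B)) := fun u v => `[< word_eq u v >].

Fact word_rel_refl : reflexive word_rel.
Proof. by move=> u; apply/asboolP; exact: word_eq_refl. Qed.
Fact word_rel_sym : symmetric word_rel.
Proof.
by move=> u v; apply/asboolP/asboolP => uv; exact: word_eq_sym.
Qed.
Fact word_rel_trans : transitive word_rel.
Proof.
move=> v u w /asboolP uv /asboolP vw; apply/asboolP; exact: word_eq_trans vw.
Qed.

Canonical word_equiv :=
  EquivRel word_rel word_rel_refl word_rel_sym word_rel_trans.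

Definition free_product := {eq_quot word_equiv}.
HB.instance Definition _ := Choice.on free_product.
HB.instance Definition _ := EqQuotient.on free_product.

Definition letter_inv (x : A + B) : A + B :=
  match x with inl a => inl a^-1 | inr b => inr b^-1 end.
Definition word_inv (u : seq (A + B)) := rev (map letter_inv u).

Fact word_inv_cat u v : word_inv (u ++ v) = word_inv v ++ word_inv u.
Proof. by rewrite /word_inv map_cat rev_cat. Qed.

Fact word_inv_eq u v : word_eq u v -> word_eq (word_inv u) (word_inv v).
Proof.
elim=> {u v}.
- by move=> u; exact: word_eq_refl.
- by move=> u v _; exact: word_eq_sym.
- by move=> v u w _ uv _; exact: word_eq_trans.
- by move=> u u' v v' _ uu' _ vv'; rewrite !word_inv_cat; exact: word_eq_cat.
- by rewrite /word_inv /= invg1; exact: word_eq_l1.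
- by rewrite /word_inv /= invg1; exact: word_eq_r1.
- by move=> a a'; rewrite /word_inv /= invgM; exact: word_eq_lM.
- by move=> b b'; rewrite /word_inv /= invgM; exact: word_eq_rM.
Qed.

Fact word_mulV u : word_eq (word_inv u ++ u) [::].
Proof.
elim: u => [|x u IHu]; first exact: word_eq_refl.
rewrite -cat1s word_inv_cat -catA (catA (word_inv [:: x])).
apply: word_eq_trans IHu; apply: word_eq_cat (word_eq_refl _) _.
rewrite -[X in word_eq _ X]cat0s; apply: word_eq_cat (word_eq_refl _).
case: x => x; rewrite /word_inv /=.
  by apply: word_eq_trans (word_eq_lM _ _) _; rewrite mulVg; exact: word_eq_l1.
by apply: word_eq_trans (word_eq_rM _ _) _; rewrite mulVg; exact: word_eq_r1.
Qed.

Fact word_invK : involutive word_inv.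
Proof.
move=> u; rewrite /word_inv map_rev revK mapK //.
by case=> x /=; rewrite invgK.
Qed.

Definition free_product_one : free_product := \pi_free_product [::].
Definition free_product_inv := lift_op1 free_product word_inv.
Definition free_product_mul := lift_op2 free_product cat.

Fact free_product_invE u :
  free_product_inv (\pi_free_product u) = \pi_free_product (word_inv u).
Proof.
unlock free_product_inv; case: piP => v /eqmodP/asboolP uv.
by apply/esym/eqmodP/asboolP/word_inv_eq.
Qed.

Fact free_product_mulE u v :
  free_product_mul (\pi_free_product u) (\pi_free_product v)
  = \pi_free_product (u ++ v).
Proof.
unlock free_product_mul; case: piP => u' /eqmodP/asboolP uu'.
case: piP => v' /eqmodP/asboolP vv'.
by apply/esym/eqmodP/asboolP/word_eq_cat.
Qed.

Fact free_product_mulA : associative free_product_mul.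
Proof.
move=> a b c; rewrite -[a]reprK -[b]reprK -[c]reprK.
by rewrite !free_product_mulE catA.
Qed.
Fact free_product_1mul : left_id free_product_one free_product_mul.
Proof. by move=> a; rewrite -[a]reprK free_product_mulE. Qed.
Fact free_product_mul1 : right_id free_product_one free_product_mul.
Proof. by move=> a; rewrite -[a]reprK free_product_mulE cats0. Qed.
Fact free_product_Vmul :
  left_inverse free_product_one free_product_inv free_product_mul.
Proof.
move=> a; rewrite -[a]reprK free_product_invE free_product_mulE.
by apply/eqmodP/asboolP; exact: word_mulV.
Qed.
Fact free_product_mulV :
  right_inverse free_product_one free_product_inv free_product_mul.
Proof.
move=> a; rewrite -[a]reprK free_product_invE free_product_mulE.
by apply/eqmodP/asboolP; rewrite -{1}[repr a]word_invK; exact: word_mulV.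
Qed.

HB.instance Definition _ := isGroup.Build free_product
  free_product_mulA free_product_1mul free_product_mul1
  free_product_Vmul free_product_mulV.

Definition fp_inl (a : A) : free_product := \pi_free_product [:: inl a].
Definition fp_inr (b : B) : free_product := \pi_free_product [:: inr b].
End FreeProduct.

(* A subgroup of A is a group [CA : subGroupType SA], whose inclusion
   [val : CA -> A] is an injective morphism with image [SA]. *)
Section AmalgamatedProduct.
Variables (A B : groupType) (SA : {pred A}) (SB : {pred B}).
Variables (CA : subGroupType SA) (CB : subGroupType SB) (theta : CA -> CB).

Definition amalgam_relators : set (free_product A B) :=
  [set fp_inl B (val c) * (fp_inr A (val (theta c)))^-1 | c in [set: CA]].

Definition amalgamated_product : groupType :=
  quotient_group (normal_closure amalgam_relators).
End AmalgamatedProduct.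

(* Main.v *)
Require Import Defs.
From mathcomp Require Import all_boot.
From HB Require Import structures.
From mathcomp Require Import boolp classical_sets.

(* Write T = A / C_A, and let A *_C B act on T x B: A translates T and moves
   the B-coordinate by the cocycle rep(at)^-1 a rep(t) in C_A, identified with
   an element of C_B, while B fixes T and translates the B-coordinate. The two
   actions agree on the amalgamated subgroup because A is abelian. Extending
   an action on X to X x B by a B-valued cocycle lengthens the derived series
   of the image by at most the derived length of B, so every tower of such
   extensions is an action with solvable image. For a reduced word
   b_n a_n ... b_1 a_1 one builds such a tower, one storey per syllable pair,
   in which the last coordinate of a base point changes exactly when the last
   pair is applied; hence every nontrivial element moves a point in some
   solvable action. *)

Set Implicit Arguments.
Unset Strict Implicit.
Unset Printing Implicit Defensive.

Local Open Scope group_scope.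
Local Open Scope classical_set_scope.
Local Open Scope quotient_scope.

(** * Generated subgroups, normal closures and derived series *)

Section Generated.
Variables (G : groupType) (X : set G).

Lemma mem_generated x : X x -> x \in generated X.
Proof. by move=> Xx; apply/asboolP => S; apply; rewrite inE. Qed.

Fact generatedM : mulg_closed (generated X).
Proof.
move=> x y /asboolP Hx /asboolP Hy; apply/asboolP => S XS.
by rewrite gpredM ?Hx ?Hy.
Qed.
Fact generated1 : 1 \in generated X.
Proof. by apply/asboolP => S _; rewrite gpred1. Qed.
Fact generatedV : invg_closed (generated X).
Proof. by move=> x /asboolP Hx; apply/asboolP => S XS; rewrite gpredVr ?Hx. Qed.

HB.instance Definition _ := isMulClosed.Build G (generated X) generatedM.
HB.instance Definition _ := isMul1Closed.Build G (generated X) generated1.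
HB.instance Definition _ := isInvClosed.Build G (generated X) generatedV.

Lemma generated_ind (P : G -> Prop) :
  (forall x y, P x -> P y -> P (x * y)) -> P 1 -> (forall x, P x -> P x^-1) ->
  (forall x, X x -> P x) -> forall x, x \in generated X -> P x.
Proof.
move=> PM P1 PV XP x /asboolP.
pose S : {pred G} := fun x => `[< P x >].
have SM : mulg_closed S.
  by move=> y z /asboolP Py /asboolP Pz; apply/asboolP/PM.
have S1 : 1 \in S by apply/asboolP.
have SV : invg_closed S by move=> y /asboolP Py; apply/asboolP/PV.
pose S' : groupClosed G := HB.pack S (isMulClosed.Build G S SM)
  (isMul1Closed.Build G S S1) (isInvClosed.Build G S SV).
move=> /(_ S') XS; apply/asboolP/XS => y; rewrite inE => /XP Py.
exact/asboolP.
Qed.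
End Generated.

Lemma normal_closure_ind (G : groupType) (X : set G) (P : G -> Prop) :
  (forall x y, P x -> P y -> P (x * y)) -> P 1 -> (forall x, P x -> P x^-1) ->
  (forall x g, P x -> P (x ^ g)) ->
  (forall x, X x -> P x) -> forall x, x \in normal_closure X -> P x.
Proof.
move=> PM P1 PV PJ XP x /asboolP.
pose S : {pred G} := fun x => `[< P x >].
have SM : mulg_closed S.
  by move=> y z /asboolP Py /asboolP Pz; apply/asboolP/PM.
have S1 : 1 \in S by apply/asboolP.
have SV : invg_closed S by move=> y /asboolP Py; apply/asboolP/PV.
have SJ y g : y \in S -> y ^ g \in S by move=> /asboolP Py; apply/asboolP/PJ.
pose S' : normalClosed G := HB.pack S (isMulClosed.Build G S SM)
  (isMul1Closed.Build G S S1) (isInvClosed.Build G S SV)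
  (isConjClosed.Build G S SJ).
move=> /(_ S') XS; apply/asboolP/XS => y; rewrite inE => /XP Py.
exact/asboolP.
Qed.

Fact derived_seriesM (G : groupType) n : mulg_closed (@derived_series G n).
Proof. by case: n => [|n] //; exact: generatedM. Qed.
Fact derived_series1 (G : groupType) n : 1 \in @derived_series G n.
Proof. by case: n => [|n] //; exact: generated1. Qed.
Fact derived_seriesV (G : groupType) n : invg_closed (@derived_series G n).
Proof. by case: n => [|n] //; exact: generatedV. Qed.

Lemma commg_derived_series (G : groupType) n (x y : G) :
  x \in derived_series n -> y \in derived_series n ->
  [~ x, y] \in derived_series n.+1.
Proof. by move=> xn yn; apply: mem_generated; exists x, y. Qed.

(** Multiplicativity is asked only on the [n]-th derived subgroup because [h] will be the
    B-coordinate of a skew action, which is multiplicative only where the base is fixed. Keeping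
    this membership in the conclusion lets the induction on [j] distribute [h] over commutators. *)
Lemma derived_series_morph (G H : groupType) (h : G -> H) n j :
  (forall x y, x \in derived_series n -> y \in derived_series n ->
    h (x * y) = h x * h y) ->
  forall x, x \in derived_series (n + j) ->
    x \in derived_series n /\ h x \in derived_series j.
Proof.
move=> hM.
have h1 : h 1 = 1.
  by apply: (mulgI (h 1)); rewrite -hM ?derived_series1 // !mulg1.
have hV x : x \in derived_series n -> h x^-1 = (h x)^-1.
  move=> xn; apply: (mulgI (h x)).
  by rewrite -hM ?derived_seriesV // !mulgV.
elim: j => [|j IHj] x; first by rewrite addn0.
rewrite addnS; move: x.
pose P x := x \in derived_series n /\ h x \in derived_series j.+1.
apply: (@generated_ind _ _ P) => [x y [xn hx] [yn hy]||x [xn hx]|].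
- split; first exact: derived_seriesM.
  by rewrite hM //; exact: (@derived_seriesM _ j.+1).
- by rewrite /P h1; split; exact: derived_series1.
- split; first exact: derived_seriesV.
  by rewrite hV //; exact: (@derived_seriesV _ j.+1).
- move=> _ [x [y [/IHj[xn hx] /IHj[yn hy] ->]]].
  have xVn := derived_seriesV xn; have yVn := derived_seriesV yn.
  rewrite /commg /conjg; split; first by do !apply: derived_seriesM.
  rewrite !hM ?hV //; last by do !apply: derived_seriesM.
    exact: commg_derived_series.
  by do !apply: derived_seriesM.
Qed.

Fact derived_seriesJ (G : groupType) n (x g : G) :
  x \in derived_series n -> x ^ g \in derived_series n.
Proof.
by case/(@derived_series_morph G G (conjg^~ g) 0 n) => // y z _ _;
   exact: conjMg.
Qed.

Lemma derived_series_surj (G H : groupType) (h : G -> H) n (y : H) :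
  (forall x x', h (x * x') = h x * h x') -> (forall y, exists x, h x = y) ->
  y \in derived_series n -> exists2 x, x \in derived_series n & h x = y.
Proof.
move=> hM h_surj.
have h1 : h 1 = 1 by apply: (mulgI (h 1)); rewrite -hM !mulg1.
have hV x : h x^-1 = (h x)^-1.
  by apply: (mulgI (h x)); rewrite -hM !mulgV.
elim: n y => [|n IHn]; first by move=> y; have [x <-] := h_surj y; exists x.
apply: generated_ind.
- move=> _ _ [x xn <-] [y yn <-]; exists (x * y) => //.
  exact: (@derived_seriesM _ n.+1).
- by exists 1 => //; exact: derived_series1.
- move=> _ [x xn <-]; exists x^-1 => //.
  exact: (@derived_seriesV _ n.+1).
- move=> _ [_ [_ [/IHn[x xn <-] /IHn[y yn <-] ->]]].
  exists [~ x, y]; first exact: commg_derived_series.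
  by rewrite /commg /conjg !hM !hV.
Qed.

(** The witness is the quotient by the [n]-th derived subgroup: derived series lift along the
    projection, so this quotient is solvable. *)
Lemma residually_solvableP (G : groupType) :
  (forall g : G, g <> 1 -> exists n, g \notin derived_series n) ->
  residually_solvable G.
Proof.
move=> G_res g /G_res[n gn].
pose N : normalClosed G := HB.pack (@derived_series G n)
  (isMulClosed.Build G _ (@derived_seriesM G n))
  (isMul1Closed.Build G _ (@derived_series1 G n))
  (isInvClosed.Build G _ (@derived_seriesV G n))
  (isConjClosed.Build G _ (@derived_seriesJ G n)).
pose pi (x : G) : quotient_group N := \pi_(quotient_group N) x.
have piM x y : pi (x * y) = pi x * pi y by apply/esym/quotient_mulE.
have pi1 x : pi x = 1 <-> x \in N.
  split=> [/esym/eqmodP|xN]; first by rewrite /= /coset_rel invg1 mul1g.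
  by apply/esym/eqmodP; rewrite /= /coset_rel invg1 mul1g.
pose psi : {multiplicative G -> quotient_group N} :=
  HB.pack pi (isMultiplicative.Build _ _ pi piM).
exists (quotient_group N), psi; split; last by move=> /pi1; apply/negP.
exists n => y /(derived_series_surj piM)[].
  by move=> z; exists (repr z); exact: reprK.
by move=> x xn <-; apply/pi1.
Qed.

(** * Actions of free products *)

Definition is_action (G : groupType) (X : Type) (act : G -> X -> X) : Prop :=
  (forall x, act 1 x = x) /\ (forall g h x, act (g * h) x = act g (act h x)).

Section FreeProductAction.
Variables (A B : groupType) (X : Type).
Variables (alpha : A -> X -> X) (beta : B -> X -> X).
Hypotheses (alphaP : is_action alpha) (betaP : is_action beta).

Definition word_act (w : seq (A + B)) (x : X) : X :=
  foldr (fun l => match l with inl a => alpha a | inr b => beta b end) x w.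

Lemma word_act_eq u v : word_eq u v -> word_act u =1 word_act v.
Proof.
have [a1 aM] := alphaP; have [b1 bM] := betaP.
elim=> {u v} //=.
- by move=> u v _ uv x; rewrite uv.
- by move=> v u w _ uv _ vw x; rewrite uv vw.
- move=> u u' v v' _ uu' _ vv' x.
  by rewrite /word_act !foldr_cat -!/(word_act _ _) vv' uu'.
- by move=> a a' x; rewrite /= aM.
- by move=> b b' x; rewrite /= bM.
Qed.

Definition free_product_act (p : free_product A B) : X -> X :=
  word_act (repr p).

Lemma free_product_actE w x :
  free_product_act (\pi_(free_product A B) w) x = word_act w x.
Proof.
rewrite /free_product_act; apply: word_act_eq.
have /eqmodP/asboolP // := reprK (\pi_(free_product A B) w).
Qed.

Lemma free_product_actP : is_action free_product_act.
Proof.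
split=> [x|p q x]; first exact: free_product_actE.
rewrite -[p]reprK -[q]reprK -[X in free_product_act X]/(free_product_mul _ _).
by rewrite free_product_mulE !free_product_actE /word_act foldr_cat.
Qed.
End FreeProductAction.

(** * Generators and actions of the amalgamated product *)

Section Amalgam.
Variables (A B : groupType) (SA : {pred A}) (SB : {pred B}).
Variables (CA : subGroupType SA) (CB : subGroupType SB).
Variable theta : {multiplicative CA -> CB}.

Local Notation N := (normal_closure (amalgam_relators theta)).
Local Notation G := (amalgamated_product theta).

Definition amalgam_inl (a : A) : G := \pi_(quotient_group N) (fp_inl B a).
Definition amalgam_inr (b : B) : G := \pi_(quotient_group N) (fp_inr A b).

Lemma amalgam_inlM a a' : amalgam_inl (a * a') = amalgam_inl a * amalgam_inl a'.
Proof.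
rewrite -[RHS]/(quotient_mul _ _) quotient_mulE.
congr (\pi_(quotient_group N) _).
rewrite -[RHS]/(free_product_mul _ _) free_product_mulE.
by apply/esym/eqmodP/asboolP/word_eq_lM.
Qed.

Lemma amalgam_inrM b b' : amalgam_inr (b * b') = amalgam_inr b * amalgam_inr b'.
Proof.
rewrite -[RHS]/(quotient_mul _ _) quotient_mulE.
congr (\pi_(quotient_group N) _).
rewrite -[RHS]/(free_product_mul _ _) free_product_mulE.
by apply/esym/eqmodP/asboolP/word_eq_rM.
Qed.

Lemma amalgam_inl1 : amalgam_inl 1 = 1.
Proof. by apply: (mulgI (amalgam_inl 1)); rewrite -amalgam_inlM !mulg1. Qed.

Lemma amalgam_inr1 : amalgam_inr 1 = 1.
Proof. by apply: (mulgI (amalgam_inr 1)); rewrite -amalgam_inrM !mulg1. Qed.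

Lemma amalgam_glue c : amalgam_inl (val c) = amalgam_inr (val (theta c)).
Proof.
set l := fp_inl B (val c); set r := fp_inr A (val (theta c)).
apply/eqmodP; rewrite /= /coset_rel -gpredV invgM invgK.
(* The coset relation leads to [r^-1 * l], a conjugate of the relator [l * r^-1]. *)
rewrite (_ : r^-1 * l = (l * r^-1) ^ r); last by rewrite /conjg mulgVK.
apply: conj_closed; apply/asboolP => M; apply.
by rewrite inE; exists c.
Qed.

Lemma amalgam_ind (P : G -> Prop) :
  P 1 -> (forall a g, P g -> P (amalgam_inl a * g)) ->
  (forall b g, P g -> P (amalgam_inr b * g)) -> forall g, P g.
Proof.
move=> P1 Pl Pr g; rewrite -[g]reprK -[repr g]reprK.
have piM p q : \pi_(quotient_group N) (p * q) =
    \pi_(quotient_group N) p * \pi_(quotient_group N) q :> G.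
  by rewrite -[RHS]/(quotient_mul _ _) quotient_mulE.
(* The inner [repr] picks an element of the free product, the outer one a word for it. *)
elim: (repr (repr g)) => [|l w IHw] //.
rewrite -cat1s -free_product_mulE piM.
by case: l => [a|b]; [exact: Pl | exact: Pr].
Qed.

(** The universal property, phrased for actions: the elements of the free product acting trivially
    form a normal subgroup, which contains the relators by the gluing hypothesis. *)
Lemma amalgam_action (X : Type) (alpha : A -> X -> X) (beta : B -> X -> X) :
  is_action alpha -> is_action beta ->
  (forall c x, alpha (val c) x = beta (val (theta c)) x) ->
  exists act : G -> X -> X, [/\ is_action act,
    forall a x, act (amalgam_inl a) x = alpha a x &
    forall b x, act (amalgam_inr b) x = beta b x].
Proof.
move=> alphaP betaP glue.
have [f1 fM] := free_product_actP alphaP betaP.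
set f := free_product_act alpha beta in f1 fM.
have fV p x : f p (f p^-1 x) = x by rewrite -fM mulgV f1.
have Vf p x : f p^-1 (f p x) = x by rewrite -fM mulVg f1.
have fl a x : f (fp_inl B a) x = alpha a x by apply: free_product_actE.
have fr b x : f (fp_inr A b) x = beta b x by apply: free_product_actE.
have fN : forall p, p \in N -> forall x, f p x = x.
  apply: normal_closure_ind.
  - by move=> p q fp fq x; rewrite fM fq fp.
  - exact: f1.
  - by move=> p fp x; rewrite -[in LHS](fp x) Vf.
  - by move=> p q fp x; rewrite !fM fp Vf.
  - by move=> _ [c _ <-] x; rewrite fM fl glue -fr fV.
pose act (g : G) := f (repr g).
have actE p x : act (\pi_(quotient_group N) p) x = f p x.
  have /eqmodP := reprK (\pi_(quotient_group N) p).
  rewrite /= /coset_rel => /fN fp.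
  rewrite -[RHS](fV (repr (\pi_(quotient_group N) p))).
  by rewrite -[X in f _ X]fM fp.
exists act; split => [|a x|b x]; rewrite ?actE //.
split=> [x|g h x]; first by rewrite actE f1.
rewrite -[g]reprK -[h]reprK -[X in act X]/(quotient_mul _ _).
by rewrite quotient_mulE !actE fM.
Qed.
End Amalgam.

(** * Skew products and the base action *)

Section SeparatingActions.
Variables (A B : groupType).
Hypotheses (A_ab : abelian_group A) (B_sol : solvable_group B).
Variables (SA : {pred A}) (SB : {pred B}).
Variables (CA : subGroupType SA) (CB : subGroupType SB).
Variable theta : {multiplicative CA -> CB}.
Hypothesis theta_bij : bijective theta.

Local Notation G := (amalgamated_product theta).
Local Notation iA := (amalgam_inl theta).
Local Notation iB := (amalgam_inr theta).

Definition solvable_action (X : Type) (act : G -> X -> X) : Prop :=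
  exists n, forall g, g \in derived_series n -> forall x, act g x = x.

(** The identities on [kA] and [kB] are cocycle conditions. Where the [n]-th derived subgroup fixes
    [X], it acts on each fibre by left translations through a homomorphism to [B], and the derived
    length of [B] kills these. *)
Lemma skew_action (X : Type) (act : G -> X -> X)
    (kA : A -> X -> B) (kB : B -> X -> B) :
  is_action act -> solvable_action act ->
  (forall a a' x, kA (a * a') x = kA a (act (iA a') x) * kA a' x) ->
  (forall b b' x, kB (b * b') x = kB b (act (iB b') x) * kB b' x) ->
  (forall c x, kA (val c) x = kB (val (theta c)) x) ->
  exists act' : G -> X * B -> X * B,
    [/\ is_action act', solvable_action act',
        forall g y, (act' g y).1 = act g y.1,
        forall a x z, act' (iA a) (x, z) = (act (iA a) x, kA a x * z) &
        forall b x z, act' (iB b) (x, z) = (act (iB b) x, kB b x * z)].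
Proof.
move=> [act1 actM] [n act_n] kAM kBM glue.
pose alpha a (y : X * B) := (act (iA a) y.1, kA a y.1 * y.2).
pose beta b (y : X * B) := (act (iB b) y.1, kB b y.1 * y.2).
have alphaP : is_action alpha.
  split=> [[x z]|a a' [x z]]; last first.
    by rewrite /alpha /= amalgam_inlM actM kAM mulgA.
  rewrite /alpha /= amalgam_inl1 act1; congr pair.
  suff -> : kA 1 x = 1 by rewrite mul1g.
  by apply: (mulgI (kA 1 x)); rewrite mulg1 -{3}(mulg1 1) kAM amalgam_inl1 act1.
have betaP : is_action beta.
  split=> [[x z]|b b' [x z]]; last first.
    by rewrite /beta /= amalgam_inrM actM kBM mulgA.
  rewrite /beta /= amalgam_inr1 act1; congr pair.
  suff -> : kB 1 x = 1 by rewrite mul1g.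
  by apply: (mulgI (kB 1 x)); rewrite mulg1 -{3}(mulg1 1) kBM amalgam_inr1 act1.
have [|act' [act'P actA actB]] := amalgam_action (theta := theta) alphaP betaP.
  by move=> c [x z]; rewrite /alpha /beta /= amalgam_glue glue.
have [act'1 act'M] := act'P.
have act'1E g y : (act' g y).1 = act g y.1.
  elim/amalgam_ind: g => [|a g IHg|b g IHg]; first by rewrite act'1 act1.
    by rewrite act'M actA /= IHg actM.
  by rewrite act'M actB /= IHg actM.
exists act'; split => //.
(* The action commutes with right translations of the B-coordinate, so the points [(x, 1)] decide
   everything. *)
have act'2E g x z : (act' g (x, z)).2 = (act' g (x, 1)).2 * z.
  elim/amalgam_ind: g => [|a g IHg|b g IHg]; first by rewrite !act'1 /= mul1g.
    by rewrite !act'M !actA /= !act'1E IHg mulgA.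
  by rewrite !act'M !actB /= !act'1E IHg mulgA.
have [d B_d] := B_sol; exists (n + d)%N => g gnd [x z].
have hM g1 g2 : g1 \in derived_series n -> g2 \in derived_series n ->
    (act' (g1 * g2) (x, 1)).2 = (act' g1 (x, 1)).2 * (act' g2 (x, 1)).2.
  move=> g1n g2n; rewrite act'M.
  by rewrite [act' g2 _]surjective_pairing act'1E /= (act_n g2) //.
have [gn /B_d hg] := derived_series_morph hM gnd.
by rewrite [LHS]surjective_pairing act'1E act'2E hg mul1g /= act_n.
Qed.

Let memSA (c : CA) : val c \in SA. Proof. exact: valP. Qed.
Let memSB (c : CB) : val c \in SB. Proof. exact: valP. Qed.

Let SA_val a : a \in SA -> exists c : CA, a = val c.
Proof. by move=> aS; exists (Sub a aS); rewrite SubK. Qed.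

Let SB_val b : b \in SB -> exists c : CA, b = val (theta c).
Proof.
move=> bS; have [g _ gK] := theta_bij.
by exists (g (Sub b bS)); rewrite gK SubK.
Qed.

(** A total extension of [theta]; outside [SA] the default of [insubd] gives the value 1, so it is
    multiplicative only on [SA]. *)
Let rho (a : A) : B := val (theta (insubd (1 : CA) a)).

Let rhoE c : rho (val c) = val (theta c).
Proof. by rewrite /rho valKd. Qed.

Let rhoM a a' : a \in SA -> a' \in SA -> rho (a * a') = rho a * rho a'.
Proof.
by move=> /SA_val[c ->] /SA_val[c' ->]; rewrite -valM !rhoE gmulfM valM.
Qed.

Let SAM : mulg_closed SA.
Proof. by move=> _ _ /SA_val[c ->] /SA_val[c' ->]; rewrite -valM. Qed.
Let SA1 : 1 \in SA.
Proof. by rewrite -(val1 CA). Qed.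
Let SAV : invg_closed SA.
Proof. move=> _ /SA_val[c ->]; rewrite -gmulfV; exact: valP. Qed.
Let SBM : mulg_closed SB.
Proof. by move=> _ _ /SB_val[c ->] /SB_val[c' ->]; rewrite -valM. Qed.
Let SBV : invg_closed SB.
Proof. move=> _ /SB_val[c ->]; rewrite -gmulfV; exact: valP. Qed.
Let SB1 : 1 \in SB.
Proof. by rewrite -(val1 CB). Qed.
Let conjA (x y : A) : x ^ y = x.
Proof. by rewrite /conjg A_ab mulgK. Qed.
Let SAJ (x y : A) : x \in SA -> x ^ y \in SA.
Proof. by rewrite conjA. Qed.

(** The T-coordinate detects A-syllables outside [SA]; the B-coordinate makes [B] act freely. *)
Lemma base_action :
  exists (T : eqType) (t0 : T) (act : G -> T * B -> T * B),
    [/\ is_action act, solvable_action act,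
        forall a p, (act (iA a) p).1 = p.1 -> a \in SA &
        forall b t z, act (iB b) (t, z) = (t, b * z)].
Proof.
pose N : normalClosed A := HB.pack SA (isMulClosed.Build A SA SAM)
  (isMul1Closed.Build A SA SA1) (isInvClosed.Build A SA SAV)
  (isConjClosed.Build A SA SAJ).
pose T := quotient_group N; pose pi a : T := \pi_(quotient_group N) a.
have piM a a' : pi (a * a') = pi a * pi a' by apply/esym/quotient_mulE.
have piP a a' : pi a = pi a' <-> a^-1 * a' \in SA.
  by split=> [/eqmodP //|aa']; apply/eqmodP.
have pi1 (c : CA) : pi (val c) = 1 by apply/piP; rewrite mulg1; exact/SAV/valP.
have repr_pi t : pi (repr t) = t by exact: reprK.
pose alpha a (t : T) := pi a * t; pose beta (b : B) (t : T) := t.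
have alphaP : is_action alpha.
  split=> [t|a a' t]; first by rewrite /alpha [pi 1]/(1 : T) mul1g.
  by rewrite /alpha piM mulgA.
have betaP : is_action beta by [].
have [|actT [actTP actA actB]] := amalgam_action (theta := theta) alphaP betaP.
  by move=> c t; rewrite /alpha pi1 mul1g.
have [actT1 actTM] := actTP.
(* All of [G] acts on [T] by translations, which commute, so commutators act trivially. *)
have actTE g : exists a, forall t, actT g t = pi a * t.
  elim/amalgam_ind: g => [|a g [a' IHg]|b g [a' IHg]].
  - by exists 1 => t; rewrite actT1 [pi 1]/(1 : T) mul1g.
  - by exists (a * a') => t; rewrite actTM actA IHg /alpha piM mulgA.
  - by exists a' => t; rewrite actTM actB IHg.
have actT_sol : solvable_action actT.
  exists 1%N; apply: generated_ind => //.
  - by move=> x y xP yP t; rewrite actTM yP xP.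
  - by move=> x xP t; rewrite -[in LHS](xP t) -actTM mulVg actT1.
  - move=> _ [x [y [_ _ ->]]] t.
    have xy s : actT (x * y) s = actT (y * x) s.
      have [a xE] := actTE x; have [a' yE] := actTE y.
      by rewrite !actTM !xE !yE !mulgA -!piM A_ab.
    rewrite (_ : [~ x, y] = (y * x)^-1 * (x * y)).
      by rewrite actTM xy -actTM mulVg actT1.
    by rewrite /commg /conjg invgM !mulgA.
(* The cocycle of the section [repr] of the projection from [A] to [T]. *)
pose k a t := (repr (pi a * t))^-1 * a * repr t.
have kS a t : k a t \in SA.
  by rewrite /k -mulgA; apply/piP; rewrite repr_pi piM repr_pi.
have kM a a' t : rho (k (a * a') t) = rho (k a (actT (iA a') t)) * rho (k a' t).
  rewrite actA -rhoM //; congr rho.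
  by rewrite /k /alpha !mulgA mulgK -piM.
(* Commutativity of [A] removes the conjugation by [repr t], so the cocycle matches left translation
   by [B] on the amalgamated subgroup. *)
have kc (c : CA) t : rho (k (val c) t) = val (theta c).
  by rewrite /k pi1 mul1g -mulgA (A_ab (val c)) mulKg rhoE.
have [act [actP act_sol actfst _ actB']] :=
  skew_action (kA := fun a t => rho (k a t)) (kB := fun b t => b) actTP actT_sol kM (fun _ _ _ => erefl) kc.
exists T, (1 : T), act; split => //.
- move=> a [t z]; rewrite actfst actA /alpha /= -[RHS]mul1g => /mulIg/esym/piP.
  by rewrite invg1 mul1g.
- by move=> b t z; rewrite actB' actB.
Qed.


(** * Reduced words and separating towers *)

Fixpoint amalgam_word (l : seq (A * B)) : G :=
  if l is (a, b) :: l' then iB b * (iA a * amalgam_word l') else 1.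

(** The head pair acts last. Only the A-syllable acting first, in the last pair, may lie in [SA]. *)
Fixpoint reduced (l : seq (A * B)) : bool :=
  if l is (a, b) :: l' then
    [&& b \notin SB, nilp l' || (a \notin SA) & reduced l']
  else true.

(** A syllable in the amalgamated subgroup crosses to the other factor and merges with its
    neighbours; the leading [a] is unrestricted and absorbs what arrives at the front. *)
Lemma reduced_form g : exists a l, reduced l /\ g = iA a * amalgam_word l.
Proof.
elim/amalgam_ind: g => [|a g [a0 [l [l_red ->]]]|b g [a0 [l [l_red ->]]]].
- by exists 1, [::]; rewrite amalgam_inl1 mulg1.
- by exists (a * a0), l; rewrite amalgam_inlM mulgA.
have [/SB_val[c ->]|bS] := boolP (b \in SB).
  by exists (val c * a0), l; rewrite -amalgam_glue amalgam_inlM mulgA.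
case: l l_red => [|[a1 b1] l] /=.
  by exists 1, [:: (a0, b)]; rewrite /= bS amalgam_inl1 mul1g.
move=> /and3P[b1S a1S l_red].
have [/SA_val[c ->]|a0S] := boolP (a0 \in SA); last first.
  exists 1, ((a0, b) :: (a1, b1) :: l).
  by rewrite /= bS a0S b1S a1S l_red amalgam_inl1 mul1g.
rewrite amalgam_glue !mulgA -!amalgam_inrM -!mulgA.
have [/SB_val[c' ->]|b2S] := boolP (b * (val (theta c) * b1) \in SB).
  by exists (val c' * a1), l; rewrite -amalgam_glue amalgam_inlM mulgA.
exists 1, ((a1, b * (val (theta c) * b1)) :: l).
by rewrite /= b2S a1S l_red amalgam_inl1 mul1g.
Qed.

(* The function [e] tells the endpoint of the path traced by the suffixes of
   [l] apart from all earlier points. In the inductive step the new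
   B-coordinate is the coboundary of [u], where [u] is supported on the
   C-orbit of the point [q] reached just before the last B-syllable. *)
Lemma separating_action (T : eqType) (t0 : T) (act0 : G -> T * B -> T * B) l :
  is_action act0 -> solvable_action act0 ->
  (forall a p, (act0 (iA a) p).1 = p.1 -> a \in SA) ->
  (forall b t z, act0 (iB b) (t, z) = (t, b * z)) ->
  reduced l ->
  exists (X : Type) (act : G -> X -> X) (p : X -> T * B)
    (e : X -> bool) (x0 : X),
  [/\ is_action act /\ solvable_action act,
      forall g x, p (act g x) = act0 g (p x),
      forall a x, e (act (iA a) x) = e x,
      e (act (amalgam_word l) x0) &
      forall l1 l2, l = l1 ++ l2 -> ~~ nilp l1 ->
        ~~ e (act (amalgam_word l2) x0)].
Proof.
move=> act0P act0_sol act0A act0B.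
elim: l => [|[a b] l IHl] /=.
  (* The empty word has no proper suffix, so a constant [e] suffices. *)
  move=> _; exists (T * B)%type, act0, id, xpredT, (t0, 1); split=> // l1 l2.
  by case: l1.
move=> /and3P[bS aS /IHl{IHl}[X [act [p [e [x0]]]]]].
case=> -[actP act_sol] pE eA e_l e_suf.
have [act1 actM] := actP.
pose q := p (act (iA a) (act (amalgam_word l) x0)).
pose u x := if [&& e x, (p x).1 == q.1 & (p x).2 * q.2^-1 \in SB] then b else 1.
(* Testing a coset of [SB] rather than the point [q] makes [u] invariant, so its coboundary glues
   with the trivial cocycle of [A]. *)
have uC (c : CA) x : u (act (iA (val c)) x) = u x.
  rewrite /u eA pE; case: (p x) => t z; rewrite amalgam_glue act0B /=.
  suff -> : (val (theta c) * z * q.2^-1 \in SB) = (z * q.2^-1 \in SB) by [].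
  have cS := memSB (theta c); rewrite -mulgA; apply/idP/idP => zS.
    by rewrite -(mulKg (val (theta c)) (z * _)); apply/SBM/zS/SBV.
  exact: SBM.
have [||c x|act' [act'P act'_sol act'1 act'A act'B]] :=
    @skew_action X act (fun _ _ => 1) (fun b x => (u (act (iB b) x))^-1 * u x)
      actP act_sol.
- by move=> *; rewrite mul1g.
- by move=> b1 b2 x; rewrite amalgam_inrM actM !mulgA mulgK.
- by rewrite -amalgam_glue uC mulVg.
have [act'11 act'M] := act'P.
(* Along the suffixes of [l] the new coordinate stays 1, since [u] is 1 before and after each
   B-syllable. *)
have act'_suf l2 : (exists l1, l = l1 ++ l2) ->
    act' (amalgam_word l2) (x0, 1) = (act (amalgam_word l2) x0, 1).
  elim: l2 => [|[a2 b2] l2 IHl2] /= [l1 lE]; first by rewrite act'11 act1.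
  have lE2 : l = rcons l1 (a2, b2) ++ l2 by rewrite cat_rcons.
  rewrite !act'M IHl2; last by exists (rcons l1 (a2, b2)).
  rewrite act'A act'B -!actM -!mulgA; congr pair; rewrite !mulg1.
  have -> : u (act (iA a2 * amalgam_word l2) x0) = 1.
    rewrite /u actM eA (negPf (e_suf _ _ lE2 _)) //.
    by case: (l1).
  rewrite mulg1; apply/eqP; rewrite invg_eq1; apply/eqP.
  rewrite /u -[iB b2 * _]/(amalgam_word ((a2, b2) :: l2)).
  (* A proper suffix has [e] false. At all of [l], [e] holds, but moving by [a] outside [SA] gives
     [q] another T-coordinate. *)
  case: l1 lE {lE2} => [|x l1] lE; last by rewrite (negPf (e_suf _ _ lE _)).
  rewrite -[_ :: l2]lE; case: eqP => [eq_t|]; last by rewrite andbF.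
  have := @act0A a (p (act (amalgam_word l) x0)).
  rewrite -pE -/q eq_t => /(_ erefl); move: aS; rewrite lE /= => /negP aS aS'.
  by case: aS.
exists (X * B)%type, act', (fun y => p y.1), (fun y => y.2 == b), (x0, 1).
have b_neq1 : 1 != b by apply: contraNneq bS => <-.
split=> //.
- by move=> g y; rewrite act'1 pE.
- by move=> a' [x z]; rewrite act'A mul1g.
(* Just before [b] the value of [u] is [b]. After it the point has left the coset of [q], as [b] is
   not in [SB], so [u] is 1 and the new coordinate jumps from 1 to [b]. *)
- rewrite !act'M act'_suf; last by exists [::].
  rewrite act'A act'B /= !mulg1 /u eA e_l -/q !eqxx mulgV SB1 /=.
  suff /negPf-> : (p (act (iB b) (act (iA a) (act (amalgam_word l) x0)))).2 *
      q.2^-1 \notin SB by rewrite !andbF invg1 mul1g.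
  by rewrite pE -/q; case: (q) => t z; rewrite act0B /= mulgK.
- case=> // -[a1 b1] l1 l2 [_ _ lE] _.
  by rewrite act'_suf //; exists l1.
Qed.

Lemma amalgam_residually_solvable : residually_solvable G.
Proof.
apply: residually_solvableP => g g1.
suff [X [act [[act1 _] [n act_n] [x gx]]]] :
  exists (X : Type) (act : G -> X -> X),
    [/\ is_action act, solvable_action act & exists x, act g x <> x].
  by exists n; apply/negP => /act_n/(_ x).
have [T [t0 [act0 [act0P act0_sol act0A act0B]]]] := base_action.
have [a [l [l_red gE]]] := reduced_form g.
(* With no syllable pair, [g] comes from [A] and the base action already moves [(t0, 1)]. *)
have [l0|l_gt0] := boolP (nilp l).
  exists (T * B)%type, act0; split=> //; exists (t0, 1).
  move: gE; rewrite (nilP l0) /= mulg1 => gE ga.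
  have /SA_val[c aE] : a \in SA by apply: (act0A _ (t0, 1)); rewrite -gE ga.
  move: ga; rewrite gE aE amalgam_glue act0B mulg1 => -[] c1.
  case: g1; rewrite gE aE amalgam_glue c1; exact: amalgam_inr1.
have [X [act [p [e [x0 [[actP act_sol] _ eA e_l e_suf]]]]]] :=
  separating_action t0 act0P act0_sol act0A act0B l_red.
(* The leading A-factor preserves [e], which is true at the endpoint of [l] and false at [x0], the
   endpoint of the empty suffix. *)
exists X, act; split=> //; exists x0 => gx.
have [act1 actM] := actP.
have /negP[] := e_suf l [::] (esym (cats0 l)) l_gt0.
by rewrite act1 -gx gE actM eA.
Qed.
End SeparatingActions.

Theorem theorem5 (A B : groupType)
    (A_fg : finitely_generated A) (A_tf : torsion_free A)
    (A_ab : abelian_group A) (B_sol : solvable_group B)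
    (SA : {pred A}) (SB : {pred B})
    (CA : subGroupType SA) (CB : subGroupType SB)
    (theta : {multiplicative CA -> CB}) (theta_bij : bijective theta) :
  residually_solvable (amalgamated_product theta).
Proof. exact: amalgam_residually_solvable. Qed.
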